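(* Let $p$ and $q$ be prime numbers such that $p \equiv 1 \pmod 4$ and $q \equiv 3 \pmod 4$. Then $$\kappa(4pq) \equiv 0 \pmod 4.$$
   Context: A real quadratic number is a real irrational root $w$ of a quadratic polynomial with integer coefficients; $w'$ denotes its algebraic conjugate over $\mathbb{Q}$. The discriminant $\mathrm{disc}(w)$ of $w$ is $b^2-4ac$, where $aw^2+bw+c=0$ with $a,b,c\in\mathbb{Z}$, $a>0$, $\gcd(a,b,c)=1$. A real quadratic number $w$ is reduced if $w>1$ and $-1<w'<0$. For a positive non-square integer $D$, $\kappa(D)$ denotes the (finite) number of reduced real quadratic numbers $w$ with $\mathrm{disc}(w)=D$. *)

(* Defs.v *)
From HB Require Import structures.
From mathcomp Require Import all_boot all_order all_algebra.
From mathcomp Require Import finmap.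
From mathcomp Require Import boolp classical_sets functions cardinality reals.
From mathcomp Require Import zify ring lra.

Set Implicit Arguments.
Unset Strict Implicit.
Unset Printing Implicit Defensive.

Import Order.TTheory GRing.Theory Num.Theory.

Local Open Scope classical_set_scope.
Local Open Scope ring_scope.

Definition int_quad_root (R : realType) (a b c : int) (w : R) : Prop :=
  a%:~R * w ^+ 2 + b%:~R * w + c%:~R = 0.

Definition real_quadratic (R : realType) (w : R) : Prop :=
  irrational w /\ exists a b c : int, a != 0 /\ int_quad_root a b c w.

Definition conjugate_over_rat (R : realType) (w v : R) : Prop :=
  exists p : {poly rat}, [/\ irreducible_poly p,
    root (map_poly ratr p) w & root (map_poly ratr p) v].

(* The default [w] is never taken when [w] is a real quadratic number, see
   [conjE], which also shows that the conjugate other than [w] is unique. *)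
Definition conj (R : realType) (w : R) : R :=
  xget w [set v | v != w /\ conjugate_over_rat w v].

Definition primitive_quad (R : realType) (a b c : int) (w : R) : Prop :=
  [/\ 0 < a, gcdz (gcdz a b) c = 1 & int_quad_root a b c w].

(* The default [0] is never taken when [w] is a real quadratic number, see
   [primitive_quad_exists]; by [discE] the value does not depend on the
   choice of [a], [b], [c]. *)
Definition disc (R : realType) (w : R) : int :=
  xget 0 [set D | exists a b c : int,
    primitive_quad a b c w /\ D = b ^+ 2 - 4 * a * c].

Definition reduced (R : realType) (w : R) : Prop :=
  [/\ real_quadratic w, 1 < w & -1 < conj w < 0].

Definition reduced_of_disc (R : realType) (D : int) : set R :=
  [set w | reduced w /\ disc w = D].

(* [fset_set] returns the empty set on infinite sets, but the set counted here
   is finite, see [finite_reduced_of_disc]. *)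
Definition kappa (R : realType) (D : int) : nat :=
  #|` fset_set (@reduced_of_disc R D)|.

Section Facts.
Variable R : realType.
Implicit Types (w v : R) (a b c : int).

Lemma irrational_lin w (a b : int) :
  irrational w -> a%:~R * w + b%:~R = 0 -> a = 0.
Proof.
move=> iw e; apply/eqP/negPn/negP => a0; apply: iw.
exists (- b%:~R / a%:~R) => //.
rewrite fmorph_div rmorphN /= !ratr_int.
have a0R : a%:~R != 0 :> R by rewrite intr_eq0.
apply: (mulfI a0R); rewrite mulrCA divff// mulr1.
by apply/eqP; rewrite eq_sym -subr_eq0 opprK; apply/eqP.
Qed.

Lemma conjE w a b c : irrational w -> a != 0 -> int_quad_root a b c w ->
  conj w = - (b%:~R / a%:~R) - w.
Proof.
move=> iw a0 e; have a0R : a%:~R != 0 :> R by rewrite intr_eq0.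
have [v vE] : exists v, v = - (b%:~R / a%:~R) - w.
  by exists (- (b%:~R / a%:~R) - w).
rewrite -vE.
have ab : b%:~R = - (a%:~R * (v + w)) :> R.
  by rewrite vE subrK mulrN opprK mulrCA divff// mulr1.
have ac : c%:~R = a%:~R * (v * w) :> R.
  by move: e; rewrite /int_quad_root ab => e; lra.
pose p : {poly rat} := a%:~R *: 'X^2 + b%:~R *: 'X + c%:~R%:P.
have mp : map_poly ratr p = a%:~R *: (('X - w%:P) * ('X - v%:P)) :> {poly R}.
  rewrite /p !rmorphD/= !map_polyZ/= map_polyXn map_polyX map_polyC/= !ratr_int.
  by rewrite ab ac -!mul_polyC !(polyCN, polyCM, polyCD); ring.
have sp : size p = 3.
  rewrite -(size_map_poly (@ratr R)) mp size_scale//.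
  by rewrite size_mul ?polyXsubC_eq0// !size_XsubC.
have irrv r : ratr r != v.
  apply/eqP => rv; apply: iw; exists (- (b%:~R / a%:~R) - r) => //.
  rewrite rmorphB rmorphN fmorph_div /= !ratr_int rv vE; ring.
have irrp : irreducible_poly p.
  apply: cubic_irreducible; first by rewrite sp.
  move=> r; rewrite -(fmorph_root (@ratr R)) mp rootZ// rootM !root_XsubC.
  rewrite negb_or irrv andbT; apply/eqP => rw; apply: iw; by exists r.
have rp u : root (map_poly ratr p) u = (u == w) || (u == v).
  by rewrite mp rootZ// rootM !root_XsubC.
have vw : v != w.
  apply/eqP => vw; have := @irrational_lin w (2 * a) b iw.
  rewrite ab vw rmorphM/= => h.
  suff : 2 * a = 0 by move/eqP; rewrite mulf_eq0 (negPf a0).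
  by apply: h; ring.
apply: xget_unique => /=.
  split=> //; exists p; split=> //; rewrite rp eqxx ?orbT//.
move=> u [uw [q [iq qw qu]]]; apply/eqP.
have : u == w \/ u == v; last by case=> //; rewrite (negPf uw).
apply/orP; rewrite -rp.
suff pq : p %= q.
  have /eqp_root -> // : map_poly (@ratr R) p %= map_poly ratr q.
  by rewrite eqp_map.
have ncop : ~~ coprimep p q.
  apply/negP; rewrite -(coprimep_map (@ratr R)) => /coprimep_root cop.
  have /cop : root (map_poly ratr p) w by rewrite rp eqxx.
  by rewrite (eqP qw) eqxx.
have g1 : size (gcdp p q) != 1 by [].
have h1 := irrp.2 _ g1 (dvdp_gcdl p q).
have h2 := iq.2 _ g1 (dvdp_gcdr p q).
by rewrite (eqp_trans _ h2)// eqp_sym.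
Qed.

Lemma primitive_quad_exists w : real_quadratic w ->
  exists a b c, primitive_quad a b c w.
Proof.
move=> [iw [a [b [c [a0 e]]]]].
wlog ap : a b c a0 e / 0 < a.
  move=> h; case: (ltrP 0 a) => [|an]; first exact: (h a b c).
  apply: (h (- a) (- b) (- c)); rewrite ?oppr_eq0 ?oppr_gt0 ?lt_neqAle ?a0//.
  rewrite /int_quad_root !rmorphN/= !mulNr -!opprD; apply/eqP.
  by rewrite oppr_eq0; apply/eqP.
set g := gcdz (gcdz a b) c.
have ga : (g %| a)%Z by rewrite (dvdz_trans (dvdz_gcdl _ _))// dvdz_gcdl.
have gb : (g %| b)%Z by rewrite (dvdz_trans (dvdz_gcdl _ _))// dvdz_gcdr.
have gc : (g %| c)%Z by rewrite dvdz_gcdr.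
have g0 : g != 0.
  by rewrite /g gcdz_eq0 negb_and gcdz_eq0 negb_and a0.
have gp : 0 < g by rewrite lt_neqAle eq_sym g0.
move: ga gb gc => /dvdzP[a' ea] /dvdzP[b' eb] /dvdzP[c' ec].
exists a', b', c'; split.
- by move: ap; rewrite ea pmulr_lgt0.
- have : gcdz (gcdz a' b') c' * g = 1 * g.
    rewrite mul1r {2}/g ea eb ec.
    have mg x y : gcdz (x * g) (y * g) = gcdz x y * g.
      by rewrite /gcdz !abszM -muln_gcdl PoszM gtz0_abs.
    by rewrite !mg.
  exact: mulIf.
- have gR : g%:~R != 0 :> R by rewrite intr_eq0.
  apply: (mulIf gR); rewrite mul0r.
  by move: e; rewrite /int_quad_root ea eb ec !rmorphM/= => <-; ring.
Qed.

Lemma primitive_quad_inj w a b c a' b' c' : irrational w ->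
  primitive_quad a b c w -> primitive_quad a' b' c' w ->
  [/\ a = a', b = b' & c = c'].
Proof.
move=> iw [a0 g e] [a0' g' e'].
have cross : a' * b - a * b' = 0.
  apply: (@irrational_lin w _ (a' * c - a * c')) => //.
  rewrite !(rmorphB, rmorphM)/=; move: e e'; rewrite /int_quad_root => e e'.
  transitivity (a'%:~R * (a%:~R * w ^+ 2 + b%:~R * w + c%:~R)
    - a%:~R * (a'%:~R * w ^+ 2 + b'%:~R * w + c'%:~R)); first ring.
  by rewrite e e' !mulr0 subrr.
have crossc : a' * c - a * c' = 0.
  apply/eqP; rewrite -(@intr_eq0 R); apply/eqP.
  rewrite !(rmorphB, rmorphM)/=; move: e e'; rewrite /int_quad_root => e e'.
  transitivity (a'%:~R * (a%:~R * w ^+ 2 + b%:~R * w + c%:~R)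
    - a%:~R * (a'%:~R * w ^+ 2 + b'%:~R * w + c'%:~R)
    - (a' * b - a * b')%:~R * w).
    by rewrite !(rmorphB, rmorphM)/=; ring.
  by rewrite e e' cross !mulr0 mul0r !subrr.
have eb : a' * b = a * b' by apply/eqP; rewrite -subr_eq0 cross.
have ec : a' * c = a * c' by apply/eqP; rewrite -subr_eq0 crossc.
have mg (k x y : int) : 0 < k -> gcdz (k * x) (k * y) = k * gcdz x y.
  by move=> k0; rewrite /gcdz !abszM -muln_gcdr PoszM gtz0_abs.
have eg : a' * gcdz (gcdz a b) c = a * gcdz (gcdz a' b') c'.
  by rewrite -!mg// eb ec (mulrC a' a).
have ea : a = a' by move: eg; rewrite g g' !mulr1.
subst a'; have an0 : a != 0 by rewrite gt_eqF.
by split=> //; apply: (mulfI an0).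
Qed.

Lemma discE w a b c : irrational w -> primitive_quad a b c w ->
  disc w = b ^+ 2 - 4 * a * c.
Proof.
move=> iw h; apply: xget_unique => /=; first by exists a, b, c.
move=> D [a' [b' [c' [h' ->]]]].
by have [-> -> ->] := primitive_quad_inj iw h' h.
Qed.

Lemma finite_reduced_of_disc (D : int) : finite_set (@reduced_of_disc R D).
Proof.
pose N := (`|D|%N).+1.
pose f (t : 'I_N * 'I_N) : R :=
  ((t.2 : nat)%:R + Num.sqrt D%:~R) / (2 * (t.1 : nat)%:R).
apply: (@sub_finite_set _ _ (f @` [set: 'I_N * 'I_N])); last first.
  exact/finite_image/finite_finset.
move=> w [[qw w1 /andP[cw1 cw0]] dw].
have [a [b [c h]]] := primitive_quad_exists qw.
have [iw _] := qw; have := discE iw h; rewrite dw => eD.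
have [a0 _ e] := h; have an0 : a != 0 by rewrite gt_eqF.
have ew := conjE iw an0 e; move: cw1 cw0; rewrite ew => cw1 cw0.
have aR : 0 < a%:~R :> R by rewrite ltr0z.
have aR0 : a%:~R != 0 :> R by rewrite gt_eqF.
have [v vE] : exists v, v = - (b%:~R / a%:~R) - w.
  by exists (- (b%:~R / a%:~R) - w).
rewrite -vE in cw1 cw0.
have ab : b%:~R = - (a%:~R * (v + w)) :> R.
  by rewrite vE subrK mulrN opprK mulrCA divff// mulr1.
have ac : c%:~R = a%:~R * (v * w) :> R.
  by move: e; rewrite /int_quad_root ab => e; lra.
have b0 : b < 0.
  by rewrite -(ltrz0 R) ab oppr_lt0 mulr_gt0//; lra.
have c0 : c < 0.
  by rewrite -(ltrz0 R) ac pmulr_rlt0// nmulr_rlt0//; lra.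
have aN : (`|a|%N < N)%N by rewrite /N; nia.
have bN : (`|b|%N < N)%N by rewrite /N; nia.
exists (Ordinal aN, Ordinal bN) => //; rewrite /f/=.
have -> : (`|a|%N)%:R = a%:~R :> R by rewrite natr_absz gtr0_norm.
have -> : (`|b|%N)%:R = - b%:~R :> R.
  by rewrite natr_absz ltr0_norm// rmorphN.
have -> : D%:~R = (a%:~R * (w - v)) ^+ 2 :> R.
  by rewrite eD !(rmorphB, rmorphM, rmorphXn)/= ab ac; ring.
rewrite sqrtr_sqr ger0_norm; last by rewrite mulr_ge0//; lra.
by rewrite ab; field.
Qed.

End Facts.

(* Main.v *)
Require Import Defs.
From mathcomp Require Import all_boot all_order all_algebra.
From mathcomp Require Import finmap.
From mathcomp Require Import boolp classical_sets functions cardinality reals.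
From mathcomp Require Import zify ring lra.

(* Write N = pq, so N = 3 mod 4. The reduced numbers of discriminant 4N are the
   (k + sqrt N) / a with a, k, c > 0, k^2 + ac = N and |a - c| < 2k; they are
   the positive roots of the forms f = a x^2 - 2k xy - c y^2. Let chi(f) be the
   sign +1 or -1 of the odd values of f modulo 4, which is well defined as
   N = 3 mod 4. The involution w -> -1/w', which exchanges a and c, changes
   chi, so half of the forms have chi = +1. The involution
   w -> floor(w) - w' preserves chi. Its fixed points are the forms with
   2k = a floor(w), and then a or a/2 is a divisor of N below sqrt N, that is 1
   or r = min(p, q). So there are four fixed points, with a = 1, 2, r, 2r, and
   reduction modulo 8 shows that evenly many of them have chi = +1. Hence the
   number of forms with chi = +1 is even. *)

Set Implicit Arguments.
Unset Strict Implicit.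
Unset Printing Implicit Defensive.

Import Order.TTheory GRing.Theory Num.Theory.

(** * Parity and fixed points of an involution *)

Section FixedPoints.
Local Open Scope fset_scope.

(** Removing a pair [x], [f x] with [f x != x] changes neither the parity nor the fixed points;
    induct on the cardinality. *)
Lemma odd_card_fixpoints (K : choiceType) (A : {fset K}) (f : K -> K) :
  (forall x, x \in A -> f x \in A) -> (forall x, x \in A -> f (f x) = x) ->
  odd #|` A| = odd #|` [fset x in A | f x == x]|.
Proof.
have [n] := ubnP #|` A|; elim: n A => // n IHn A ltAn fA fK.
have [/existsP[[x xA] /= fx]|] := boolP [exists x : A, f (val x) != val x].
  have fxA : f x \in A `\ x by rewrite !inE fx fA.
  have cardA : #|` A| = #|` A `\ x `\ f x|.+2.
    by rewrite (cardfsD1 x) xA (cardfsD1 (f x)) fxA.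
  rewrite cardA /= negbK (IHn (A `\ x `\ f x)); last 1 first.
  - by move=> y; rewrite !inE => /and3P[_ _ /fK].
  - congr (odd #|` _|); apply/fsetP => y; rewrite !inE /=.
    have [-> | yfx] := eqVneq y (f x).
      by rewrite /= fK // (eq_sym x) (negPf fx) andbF.
    by have [-> | yx] := eqVneq y x; rewrite ?(negPf fx) ?andbF.
  - by rewrite cardA in ltAn; lia.
  - move=> y; rewrite !inE => /and3P[yfx yx yA]; rewrite fA // andbT.
    apply/andP; split; apply/eqP => e.
      by have := fK _ yA; rewrite e fK // => /eqP; rewrite eq_sym (negPf yx).
    by have := fK _ yA; rewrite e => /eqP; rewrite eq_sym (negPf yfx).
rewrite negb_exists => /forallP fixA; congr (odd #|` _|); apply/fsetP => y.
rewrite !inE /=; case yA: (y \in A) => //=.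
by have := fixA [` yA]; rewrite negbK => ->.
Qed.

End FixedPoints.

(** * Reduced forms, the two involutions and the character *)

Section Forms.
Local Open Scope ring_scope.

(* [(a, k, c)] stands for the form [a x^2 - 2k xy - c y^2]; the two inequalities
   say that it is negative at [(1, 1)] and positive at [(-1, 1)]. *)
Definition reduced_form (N : int) (t : int * int * int) : bool :=
  let: (a, k, c) := t in
  [&& 0 < a, 0 < c, k ^+ 2 + a * c == N, a < c + 2 * k & c < a + 2 * k].

Definition swap (t : int * int * int) : int * int * int :=
  let: (a, k, c) := t in (c, k, a).

(* With [s] the integer part of [sqrt N], [n] is the integer part of the root
   [w] and the new root is [n - w']. *)
Definition mirror (s : int) (t : int * int * int) : int * int * int :=
  let: (a, k, c) := t in
  let n := ((k + s) %/ a)%Z in (a, a * n - k, c + n * (2 * k - a * n)).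

(* If [a] is even then [- c] is an odd value of the form. *)
Definition chi4_pos (t : int * int * int) : bool :=
  let: (a, k, c) := t in
  if (a %% 2)%Z == 0 then (c %% 4)%Z == 3 else (a %% 4)%Z == 1.

(** For the root [w = (k + sqrt N) / a], the last three conditions are [w' < 0], [w' > -1] and
    [w > 1], with [sqrt N] rounded to its integer part [s]. *)
Lemma reduced_form_root (N s a k c : int) :
  0 <= s -> s ^+ 2 < N -> N < (s + 1) ^+ 2 ->
  reduced_form N (a, k, c) =
  [&& 0 < a, k ^+ 2 + a * c == N, k <= s, s < k + a & a <= k + s].
Proof.
move=> s0 sN Ns; apply/idP/idP.
  case/and5P => a0 c0 /eqP e h1 h2; rewrite a0 e eqxx /=; apply/and3P.
  by split; nia.
case/and5P => a0 /eqP e h1 h2 h3; rewrite /reduced_form a0 e eqxx /=.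
apply/and3P.
have k0 : 0 < k by lia.
by split; nia.
Qed.

Lemma swap_reduced N t : reduced_form N (swap t) = reduced_form N t.
Proof.
move: t => [[a k] c] /=; rewrite (mulrC c a).
by apply/and5P/and5P => -[].
Qed.

Lemma swapK : involutive swap.
Proof. by case=> [[]]. Qed.

(** If [k] is even, then [a * c] is 3 modulo 4, so one of [a], [c] is 1 and the other 3. If [k] is
    odd, then [a * c] is 2 modulo 4: exactly one of [a], [c] is odd, and it enters the two forms
    with opposite signs. *)
Lemma chi4_swap N t : (N %% 4)%Z = 3 -> reduced_form N t ->
  chi4_pos (swap t) = ~~ chi4_pos t.
Proof.
move: t => [[a k] c] N3 /and5P[_ _ /eqP e _ _]; rewrite /chi4_pos /swap.
(* With explicit residues, every nonconstant monomial of the expanded relation has a coefficient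
   divisible by 4, so [lia] can treat the monomials as atoms. *)
have [x ex] : exists x, N = 4 * x + 3 by exists (N %/ 4)%Z; lia.
rewrite ex expr2 in e; clear N3 ex.
have [i ei] : exists i, a = 4 * i + (a %% 4)%Z by exists (a %/ 4)%Z; lia.
have [j ej] : exists j, c = 4 * j + (c %% 4)%Z by exists (c %/ 4)%Z; lia.
have [l el] : exists l, k = 2 * l + (k %% 2)%Z by exists (k %/ 2)%Z; lia.
have a4 : ((a %% 4)%Z = 0 \/ (a %% 4)%Z = 1) \/
  ((a %% 4)%Z = 2 \/ (a %% 4)%Z = 3) by lia.
have c4 : ((c %% 4)%Z = 0 \/ (c %% 4)%Z = 1) \/
  ((c %% 4)%Z = 2 \/ (c %% 4)%Z = 3) by lia.
have k2 : (k %% 2)%Z = 0 \/ (k %% 2)%Z = 1 by lia.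
by case: a4 => -[] ra; case: c4 => -[] rc; case: k2 => rk;
  rewrite ra in ei; rewrite rc in ej; rewrite rk in el; subst a c k;
    do 2 case: ifP; lia.
Qed.

(** As [a] is kept, only even [a] matters. Then [k] is odd and [a] is 2 modulo 4, so
    [n * (2 * k - a * n)], the change of [c], is divisible by 4 for either parity of [n]. *)
Lemma chi4_mirror N s t : (N %% 4)%Z = 3 -> reduced_form N t ->
  chi4_pos (mirror s t) = chi4_pos t.
Proof.
move: t => [[a k] c] N3 /and5P[_ _ /eqP e _ _]; rewrite /chi4_pos /mirror.
set n := (_ %/ _)%Z.
case: ifP => // /eqP a2.
suff : ((n * (2 * k - a * n)) %% 4)%Z = 0 by lia.
have [x ex] : exists x, N = 4 * x + 3 by exists (N %/ 4)%Z; lia.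
rewrite ex expr2 in e; clear N3 ex.
have [i ei] : exists i, a = 4 * i + (a %% 4)%Z by exists (a %/ 4)%Z; lia.
have [j ej] : exists j, n = 2 * j + (n %% 2)%Z by exists (n %/ 2)%Z; lia.
have [l el] : exists l, k = 2 * l + (k %% 2)%Z by exists (k %/ 2)%Z; lia.
have [h eh] : exists h, c = 2 * h + (c %% 2)%Z by exists (c %/ 2)%Z; lia.
have a4 : (a %% 4)%Z = 0 \/ (a %% 4)%Z = 2 by lia.
have n2 : (n %% 2)%Z = 0 \/ (n %% 2)%Z = 1 by lia.
have k2 : (k %% 2)%Z = 0 \/ (k %% 2)%Z = 1 by lia.
have c2 : (c %% 2)%Z = 0 \/ (c %% 2)%Z = 1 by lia.
clearbody n.
by case: a4 => ra; case: n2 => rn; case: k2 => rk; case: c2 => rc;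
  rewrite ra in ei; rewrite rn in ej; rewrite rk in el; rewrite rc in eh;
  subst a n k c; lia.
Qed.
Section Mirror.
Variables N s : int.
Hypotheses (s0 : 0 <= s) (sN : s ^+ 2 < N) (Ns : N < (s + 1) ^+ 2).

(** Two of the bounds on the new [k] restate that [n] is the integer part of [(k + s) / a]; the
    third follows from [1 <= n] and [k <= s]. *)
Lemma mirror_reduced t : reduced_form N t -> reduced_form N (mirror s t).
Proof.
move: t => [[a k] c]; rewrite /mirror !(reduced_form_root _ _ _ s0) //.
case/and5P => a0 /eqP e h1 h2 h3; rewrite a0 /=.
move: (divz_eq (k + s) a) (modz_ge0 (k + s) (lt0r_neq0 a0)) (ltz_pmod (k + s)
  a0).
set n := (_ %/ _)%Z; set r := (_ %% _)%Z => en r0 ra.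
have n1 : 1 <= n by nia.
apply/and4P; split; [apply/eqP; rewrite -e; ring | lia | lia | nia].
Qed.

(** The second quotient is again [n], because [0 <= s - k < a]. *)
Lemma mirrorK t : reduced_form N t -> mirror s (mirror s t) = t.
Proof.
move: t => [[a k] c]; rewrite (reduced_form_root _ _ _ s0) //.
case/and5P => a0 /eqP e h1 h2 h3; rewrite /mirror.
set n := ((k + s) %/ a)%Z.
have -> : a * n - k + s = n * a + (s - k) by ring.
rewrite divzMDl ?gt_eqF // divz_small; last by lia.
by rewrite addr0; congr (_, _, _); ring.
Qed.

End Mirror.
End Forms.

(** * Fixed points of the mirror involution *)

Section MirrorFixed.
Local Open Scope ring_scope.

(** Solution of [2 * k = a * n] with [n = 2 * m]: here [a = d], [k = d * m], and [N = d * d'] with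
    [d' = d * m ^+ 2 + c]. *)
Definition even_fixed (s d d' : int) : int * int * int :=
  let m := (s %/ d)%Z in (d, d * m, d' - d * m ^+ 2).

(* For [0 < d <= s], the largest odd [n] with [d * n <= s]. *)
Definition odd_quot (s d : int) : int := 2 * (((s %/ d)%Z + 1) %/ 2)%Z - 1.

(** Solution of [2 * k = a * n] with [n] odd: here [a = 2 * d], [k = d * n], and [N = d * d'] with
    [d' = d * n ^+ 2 + 2 * c]. *)
Definition odd_fixed (s d d' : int) : int * int * int :=
  let n := odd_quot s d in
  (2 * d, d * n, ((d' - d * n ^+ 2) %/ 2)%Z).

Lemma odd_square_mod8 n : (n %% 2)%Z = 1 :> int -> exists x, n ^+ 2 = 8 * x + 1.
Proof.
move=> n2; have [i ei] : exists i, n = 4 * i + (n %% 4)%Z by exists (n %/ 4)%Z;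
  lia.
have [r|r] : (n %% 4)%Z = 1 \/ (n %% 4)%Z = 3 by lia.
- by exists (2 * i ^+ 2 + i); rewrite ei r; ring.
- by exists (2 * i ^+ 2 + 3 * i + 1); rewrite ei r; ring.
Qed.

Lemma odd_mul (x y : int) : ((x * y) %% 2)%Z = 1 -> (x %% 2)%Z = 1 /\
  (y %% 2)%Z = 1.
Proof.
have [i ei] : exists i, x = 2 * i + (x %% 2)%Z by exists (x %/ 2)%Z; lia.
have [j ej] : exists j, y = 2 * j + (y %% 2)%Z by exists (y %/ 2)%Z; lia.
have x2 : (x %% 2)%Z = 0 \/ (x %% 2)%Z = 1 by lia.
have y2 : (y %% 2)%Z = 0 \/ (y %% 2)%Z = 1 by lia.
by case: x2 => rx; case: y2 => ry; rewrite rx in ei; rewrite ry in ej;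
  subst x y; lia.
Qed.

Lemma odd_quotP (s d : int) : 0 < d -> d <= s ->
  let n := odd_quot s d in
  [/\ (n %% 2)%Z = 1, 1 <= n, d * n <= s & s < d * n + 2 * d].
Proof.
move=> d0 ds n; rewrite {}/n /odd_quot.
move: (divz_eq s d) (modz_ge0 s (lt0r_neq0 d0)) (ltz_pmod s d0).
set q := (s %/ d)%Z; set r := (s %% d)%Z => es r0 rd.
have q1 : 1 <= q by nia.
set h := ((q + 1) %/ 2)%Z; have hq : h * 2 = q \/ h * 2 = q + 1 by lia.
clearbody q r h; split; [lia | lia | case: hq => hq; nia | case: hq => hq; nia].
Qed.

(** * The character at the fixed points *)

Section Characters.
Variables N s : int.
Hypothesis N3 : (N %% 4)%Z = 3.

Lemma chi4_even_fixed (d d' : int) : d * d' = N ->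
  chi4_pos (even_fixed s d d') = ((d %% 4)%Z == 1).
Proof.
move=> dN; have [|d2 d'2] := @odd_mul d d'; first by rewrite dN; lia.
by rewrite /chi4_pos /even_fixed d2.
Qed.

(** Here [a] is even, so the test is whether [c] is 3 modulo 4; since [n ^+ 2] is 1 modulo 8,
    [2 * c] is [d' - d] modulo 8. *)
Lemma chi4_odd_fixed (d d' : int) : 0 < d -> d <= s -> d * d' = N ->
  chi4_pos (odd_fixed s d d') = (((d' - d) %% 8)%Z == 6).
Proof.
move=> d0 ds dN; have [|d2 d'2] := @odd_mul d d'; first by rewrite dN; lia.
rewrite /chi4_pos /odd_fixed modzMr eqxx; cbv zeta.
have := odd_quotP d0 ds; cbv zeta; set n := odd_quot s d => -[n2 n1 h1 h2].
have [x ->] := odd_square_mod8 n2.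
by clear -d2 d'2; lia.
Qed.

(** The four values are true, [N = 7 mod 8], [r = 1 mod 4] and [r' - r = 6 mod 8]. As
    [N = 1 + r * (r' - r)] modulo 8 and [r' - r] is 2 modulo 4, the second and fourth agree exactly
    when the third holds. *)
Lemma chi4_fixed_even (r r' : int) : 0 < r -> r <= s -> r * r' = N ->
  odd (chi4_pos (even_fixed s 1 N) + chi4_pos (odd_fixed s 1 N)
    + chi4_pos (even_fixed s r r') + chi4_pos (odd_fixed s r r')) = false.
Proof.
move=> r0 rs rN; rewrite !chi4_even_fixed ?mul1r // !chi4_odd_fixed ?mul1r //;
  last by lia.
have [i ei] : exists i, r = 8 * i + (r %% 8)%Z by exists (r %/ 8)%Z; lia.
have [j ej] : exists j, r' = 8 * j + (r' %% 8)%Z by exists (r' %/ 8)%Z; lia.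
have [|r2 r'2] := @odd_mul r r'; first by rewrite rN; lia.
have r8 : ((r %% 8)%Z = 1 \/ (r %% 8)%Z = 3) \/
  ((r %% 8)%Z = 5 \/ (r %% 8)%Z = 7) by lia.
have r'8 : ((r' %% 8)%Z = 1 \/ (r' %% 8)%Z = 3) \/
  ((r' %% 8)%Z = 5 \/ (r' %% 8)%Z = 7) by lia.
by case: r8 => -[] e; case: r'8 => -[] e'; rewrite e in ei; rewrite e' in ej;
  move: rN; rewrite ei ej => rN; clear -rN N3; lia.
Qed.

End Characters.

(** * Classification of the fixed forms by divisors of [N] *)

Section Fixed.
Variables N s : int.
Hypotheses (s0 : 0 <= s) (sN : s ^+ 2 < N) (Ns : N < (s + 1) ^+ 2).

Lemma even_fixedP (d d' : int) : 0 < d -> d <= s -> d * d' = N ->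
  let t := even_fixed s d d' in reduced_form N t /\ mirror s t = t.
Proof.
move=> d0 ds dN t; rewrite {}/t /even_fixed.
move: (divz_eq s d) (modz_ge0 s (lt0r_neq0 d0)) (ltz_pmod s d0).
set m := (s %/ d)%Z; set r := (s %% d)%Z => es r0 rd; split.
  rewrite (reduced_form_root _ _ _ s0) // d0 /=; have m1 : 1 <= m by nia.
  apply/and4P; split; [apply/eqP; rewrite -dN; ring | lia | lia | nia].
rewrite /mirror; have -> : d * m + s = (2 * m) * d + r by rewrite es; ring.
rewrite divzMDl ?gt_eqF // divz_small; last by lia.
by rewrite addr0; congr (_, _, _); ring.
Qed.

Lemma mirror_fixed t : reduced_form N t -> mirror s t = t ->
  exists d d' : int, [/\ 0 < d, d <= s, d * d' = N
    & t = even_fixed s d d' \/ t = odd_fixed s d d'].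
Proof.
move: t => [[a k] c]; rewrite (reduced_form_root _ _ _ s0) //.
case/and5P => a0 /eqP e h1 h2 h3; rewrite /mirror.
have k0 : 0 < k by lia.
(* The middle entries give [2 * k = a * n]; the parity of [n] decides between the two families. *)
set n := ((k + s) %/ a)%Z => -[ek _].
have n0 : 0 < n by clearbody n; nia.
have [n2|n2] : (n %% 2)%Z = 0 \/ (n %% 2)%Z = 1 by lia.
  have [m en] : exists m, n = 2 * m by exists (n %/ 2)%Z; lia.
  have {}ek : k = a * m by rewrite en in ek; lia.
  exists a, (a * m ^+ 2 + c); split => //.
    have m0 : 1 <= m by rewrite -gtz0_ge1 -(pmulr_rgt0 _ a0) -ek.
    by rewrite (le_trans _ h1) // ek ler_peMr // ltW.
    by rewrite -e ek; ring.
  left; rewrite /even_fixed; have -> : (s %/ a)%Z = m.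
    have -> : s = m * a + (s - k) by rewrite ek; ring.
    by rewrite divzMDl ?gt_eqF // divz_small ?addr0 //; lia.
  by rewrite ek; congr (_, _, _); ring.
have [m en] : exists m, n = 2 * m + 1 by exists (n %/ 2)%Z; lia.
(* From [a * (2 * m + 1) = 2 * k] one gets [a = 2 * (k - a * m)]. *)
have [d ed] : exists d, a = 2 * d by exists (k - a * m); rewrite en in ek; lia.
have {}ek : k = d * n by rewrite ed in ek; lia.
clearbody n; subst a.
exists d, (d * n ^+ 2 + 2 * c); split => //; [lia | | |].
    have d0 : 0 < d by lia.
    have n1 : 1 <= n by lia.
    by rewrite (le_trans _ h1) // ek ler_peMr // ltW.
  by rewrite -e ek; ring.
right; rewrite /odd_fixed; have -> : odd_quot s d = n.
  rewrite /odd_quot.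
  have d0 : 0 < d by lia.
  move: (divz_eq s d) (modz_ge0 s (lt0r_neq0 d0)) (ltz_pmod s d0).
  set q := (s %/ d)%Z; set r := (s %% d)%Z => es r0 rd; clearbody q r.
  have qn : n <= q by nia.
  have qn2 : q < n + 2 by nia.
  by lia.
have -> : d * n ^+ 2 + 2 * c - d * n ^+ 2 = c * 2 by ring.
by rewrite mulzK // ek.
Qed.

Hypothesis N3 : (N %% 4)%Z = 3.

(** As [N] is odd, so are [d] and [d']; with [n] odd, the halving in [odd_fixed] is exact. *)
Lemma odd_fixedP (d d' : int) : 0 < d -> d <= s -> d * d' = N ->
  let t := odd_fixed s d d' in reduced_form N t /\ mirror s t = t.
Proof.
move=> d0 ds dN t; rewrite {}/t /odd_fixed; cbv zeta.
have := odd_quotP d0 ds; cbv zeta; set n := odd_quot s d => -[n2 n1 h1 h2].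
have [|d2 d'2] := @odd_mul d d'; first by rewrite dN; lia.
have [x ex] := odd_square_mod8 n2.
have [c ec] : exists c, d' - d * n ^+ 2 = c * 2.
  by exists ((d' - d * n ^+ 2) %/ 2)%Z; rewrite ex; lia.
rewrite ec mulzK //; split.
  rewrite (reduced_form_root _ _ _ s0) // mulr_gt0 //=.
  have dn : d <= d * n by rewrite ler_peMr // ltW.
  apply/and4P; split; [apply/eqP | exact: h1 | exact: h2 | clear -dn ds; lia].
  have d'E : d' = c * 2 + d * n ^+ 2 by rewrite -ec; ring.
  by rewrite -dN d'E; ring.
rewrite /mirror; have -> : d * n + s = n * (2 * d) + (s - d * n) by ring.
rewrite divzMDl ?gt_eqF ?mulr_gt0 // divz_small; last by lia.
by rewrite addr0; congr (_, _, _); ring.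
Qed.

End Fixed.

(** If [r] divides [d], the cofactor divides [r']; otherwise [d] itself divides [r']. A factor [r']
    in [d] would make [d * d] too large. *)
Lemma small_divisor_pq (r r' d d' : nat) : prime r -> prime r' ->
  (r < r')%N -> (d * d' = r * r')%N -> (d * d < r * r')%N -> d = 1%N \/ d = r.
Proof.
move=> rp r'p rr' e dd.
have r0 := prime_gt0 rp; have r'0 := prime_gt0 r'p.
have nt x : (x %| r')%N -> x = 1%N \/ x = r'.
  by have /primeP[_ h] := r'p; move=> /h /orP[] /eqP; [left | right].
have [/dvdnP[x ex]|rd] := boolP (r %| d)%N.
  have ex' : (x * d' = r')%N.
    by apply/eqP; rewrite -(eqn_pmul2l r0) -e ex; apply/eqP; lia.
  have [xE|x'] : x = 1%N \/ x = r' by apply: nt; rewrite -ex' dvdn_mulr.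
    by right; rewrite ex xE mul1n.
  by move: dd; rewrite ex x'; nia.
have [dE|d'E] : d = 1%N \/ d = r'.
- apply: nt; rewrite -(@Gauss_dvdr d r) -?e ?dvdn_mulr //.
  by rewrite coprime_sym prime_coprime.
- by left.
- by move: dd; rewrite d'E; nia.
Qed.

End MirrorFixed.

(** * Reduced numbers of discriminant [4 * N] as roots of reduced forms *)

Section ReducedNumbers.
Local Open Scope classical_set_scope.
Local Open Scope ring_scope.
Variable R : realType.
Variable N : int.
Hypotheses (N0 : 0 < N) (N3 : (N %% 4)%Z = 3).

Let S : R := Num.sqrt N%:~R.

Lemma sqrt_sqrN : S ^+ 2 = N%:~R.
Proof. by rewrite sqr_sqrtr // ler0z ltW. Qed.

(** Modulo 4, [n ^+ 2 = 3 * d ^+ 2] forces [n] and [d] to be even, against a fraction in lowest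
    terms. *)
Lemma sqrt_irrational : irrational S.
Proof.
case=> x _ e; have : (x ^+ 2 = N%:~R)%R.
  by apply: (fmorph_inj (@ratr R)); rewrite rmorphXn /= e sqrt_sqrN ratr_int.
move=> xN; have d0 : denq x != 0 by rewrite denq_neq0.
have {xN} : (numq x) ^+ 2 = N * (denq x) ^+ 2.
  apply/eqP; rewrite -(@eqr_int rat) intrM !rmorphXn /= numqE exprMn xN.
  by [].
have := coprime_num_den x.
move: (numq x) (denq x) => n d cop.
have [y ey] : exists y, N = 4 * y + 3 by exists (N %/ 4)%Z; lia.
have [i ei] : exists i, n = 2 * i + (n %% 2)%Z by exists (n %/ 2)%Z; lia.
have [j ej] : exists j, d = 2 * j + (d %% 2)%Z by exists (d %/ 2)%Z; lia.
have n2 : (n %% 2)%Z = 0 \/ (n %% 2)%Z = 1 by lia.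
have d2 : (d %% 2)%Z = 0 \/ (d %% 2)%Z = 1 by lia.
case: n2 => rn; case: d2 => rd; rewrite rn in ei; rewrite rd in ej;
  rewrite ei ej ey; try (clear; lia).
move=> _; have : (2 %| gcdn `|n| `|d|)%N by rewrite dvdn_gcd; lia.
by rewrite (eqP cop).
Qed.

Definition form_root (t : int * int * int) : R :=
  let: (a, k, c) := t in (k%:~R + S) / a%:~R.

(** Equal roots give an integral linear relation for [sqrt N]; irrationality yields [a], then [k],
    and [N] determines [c]. *)
Lemma form_root_inj :
  {in [pred t | reduced_form N t] &, injective form_root}.
Proof.
move=> [[a k] c] [[a' k'] c'] /=; rewrite !inE /reduced_form.
case/and5P => a0 _ /eqP e _ _ /and5P[a0' _ /eqP e' _ _] eq.
have : (a' - a)%:~R * S + (a' * k - a * k')%:~R = 0.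
  have aR : a%:~R != 0 :> R by rewrite intr_eq0 gt_eqF.
  have aR' : a'%:~R != 0 :> R by rewrite intr_eq0 gt_eqF.
  have : a%:~R * a'%:~R * ((k%:~R + S) / a%:~R) =
         a%:~R * a'%:~R * ((k'%:~R + S) / a'%:~R) by rewrite eq.
  have -> : a%:~R * a'%:~R * ((k%:~R + S) / a%:~R) = a'%:~R * (k%:~R + S)
    by field.
  have -> : a%:~R * a'%:~R * ((k'%:~R + S) / a'%:~R) = a%:~R * (k'%:~R + S)
    by field.
  by rewrite !rmorphB !rmorphM /= => h; lra.
move=> h; have ea : a' = a.
  by apply/eqP; rewrite -subr_eq0 (irrational_lin sqrt_irrational h).
subst a'; move: h; rewrite subrr mul0r add0r => /eqP.
rewrite intr_eq0 -mulrBr mulf_eq0 gt_eqF //= subr_eq0 => /eqP ek.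
have /(mulfI (lt0r_neq0 a0)) -> : a * c = a * c' by rewrite ek in e; lia.
by rewrite ek.
Qed.

Hypothesis N_sqfree : forall g : int, 0 < g -> (g ^+ 2 %| N)%Z -> g = 1.

(** An even common divisor would make [N] a square modulo 4; an odd one, [g], divides [k] as well,
    so [g ^+ 2] divides [N]. *)
Lemma reduced_form_primitive a k c : k ^+ 2 + a * c = N -> 0 < a ->
  gcdz (gcdz a (- (2 * k))) (- c) = 1.
Proof.
move=> e a0; set g := gcdz _ _.
have /dvdzP[a' ea] : (g %| a)%Z
  by rewrite (dvdz_trans (dvdz_gcdl _ _)) // dvdz_gcdl.
have /dvdzP[k' ek] : (g %| - (2 * k))%Z
  by rewrite (dvdz_trans (dvdz_gcdl _ _)) // dvdz_gcdr.
have /dvdzP[c' ec] : (g %| - c)%Z by rewrite dvdz_gcdr.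
have g0 : 0 < g by rewrite lt_neqAle eq_sym /g !gcdz_eq0 (gt_eqF a0) /=.
have {}ec : c = - c' * g by lia.
clearbody g.
have [y ey] : exists y, N = 4 * y + 3 by exists (N %/ 4)%Z; lia.
have [h eh] : exists h, g = 2 * h + (g %% 2)%Z by exists (g %/ 2)%Z; lia.
have g2 : (g %% 2)%Z = 1.
  have [r|//] : (g %% 2)%Z = 0 \/ (g %% 2)%Z = 1 by lia.
  have [i ei] : exists i, k = 2 * i + (k %% 2)%Z by exists (k %/ 2)%Z; lia.
  have k2 : (k %% 2)%Z = 0 \/ (k %% 2)%Z = 1 by lia.
  rewrite r addr0 in eh; move: e; rewrite ea ec ey ei eh.
  by case: k2 => ->; clear; lia.
have [i ei] : exists i, k' = 2 * i + (k' %% 2)%Z by exists (k' %/ 2)%Z; lia.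
have k'2 : (k' %% 2)%Z = 0 \/ (k' %% 2)%Z = 1 by lia.
rewrite g2 in eh; have {}ek : k = - i * g.
  case: k'2 => r; rewrite r in ei; move: ek; rewrite ei; last by rewrite eh;
    lia.
  by lia.
apply: N_sqfree => //; apply/dvdzP; exists (i ^+ 2 - a' * c').
by rewrite -e ea ec ek; ring.
Qed.

Lemma form_root_reduced t : reduced_form N t ->
  reduced (form_root t) /\ disc (form_root t) = 4 * N.
Proof.
move: t => [[a k] c]; rewrite /reduced_form => /and5P[a0 c0 /eqP e h1 h2].
rewrite /form_root; set w := (_ / _).
have aR : 0 < a%:~R :> R by rewrite ltr0z.
have aR0 : a%:~R != 0 :> R by rewrite gt_eqF.
have S0 : 0 <= S by rewrite sqrtr_ge0.
have SN : S ^+ 2 = k%:~R ^+ 2 + a%:~R * c%:~R.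
  by rewrite sqrt_sqrN -e rmorphD rmorphXn rmorphM.
have cR : 0 < c%:~R :> R by rewrite ltr0z.
have h1R : a%:~R < c%:~R + 2 * k%:~R :> R.
  by rewrite -(ltr_int R) rmorphD rmorphM in h1.
have h2R : c%:~R < a%:~R + 2 * k%:~R :> R.
  by rewrite -(ltr_int R) rmorphD rmorphM in h2.
have iw : irrational w.
  case=> x _ ex; apply: sqrt_irrational; exists (a%:~R * x - k%:~R) => //.
  rewrite rmorphB rmorphM /= !ratr_int ex /w -/S; field.
  by [].
have qw : int_quad_root a (- (2 * k)) (- c) w.
  rewrite /int_quad_root !rmorphN rmorphM /= /w.
  transitivity ((S ^+ 2 - (k%:~R ^+ 2 + a%:~R * c%:~R)) / a%:~R); first
    by field.
  by rewrite SN subrr mul0r.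
have pw : primitive_quad a (- (2 * k)) (- c) w.
  by split => //; apply: reduced_form_primitive.
split; last by rewrite (discE iw pw) -e; ring.
split.
- by split => //; exists a, (- (2 * k)), (- c); rewrite gt_eqF.
(* Each bound on [w] and [w'] follows by negating it, squaring the resulting bound on [S] and
   inserting [SN]. *)
- rewrite /w ltr_pdivlMr // mul1r ltNge; apply/negP => h.
  have hS : S <= a%:~R - k%:~R by lra.
  have := ler_pM S0 S0 hS hS; rewrite -expr2 SN => h3.
  have : 0 < a%:~R * (c%:~R + 2 * k%:~R - a%:~R) :> R
    by rewrite mulr_gt0 ?subr_gt0.
  by lra.
rewrite (conjE iw _ qw) ?gt_eqF // rmorphN rmorphM /=.
have -> : - (- (2 * k%:~R) / a%:~R) - w = (k%:~R - S) / a%:~R.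
  by rewrite /w; field.
rewrite ltr_pdivlMr // ltr_pdivrMr // mul0r !ltNge.
apply/andP; split; apply/negP => h.
  have hS : a%:~R + k%:~R <= S by lra.
  have k0 : 0 <= a%:~R + k%:~R :> R by lra.
  have := ler_pM k0 k0 hS hS; rewrite -[S * S]expr2 SN => h3.
  have : 0 < a%:~R * (a%:~R + 2 * k%:~R - c%:~R) :> R
    by rewrite mulr_gt0 ?subr_gt0.
  by lra.
have hS : S <= k%:~R by lra.
have := ler_pM S0 S0 hS hS; rewrite -[S * S]expr2 SN => h3.
have : 0 < a%:~R * c%:~R :> R by rewrite mulr_gt0.
by lra.
Qed.

Lemma reduced_is_form_root w : reduced w -> disc w = 4 * N ->
  exists2 t, reduced_form N t & form_root t = w.
Proof.
move=> [qw w1 /andP[cw1 cw0]] dw.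
have [a [b [c h]]] := primitive_quad_exists qw.
have [iw _] := qw; have := discE iw h; rewrite dw => eD.
have [a0 _ e] := h; have an0 : a != 0 by rewrite gt_eqF.
have ew := conjE iw an0 e; move: cw1 cw0; rewrite ew => cw1 cw0.
have aR : 0 < a%:~R :> R by rewrite ltr0z.
have aR0 : a%:~R != 0 :> R by rewrite gt_eqF.
have [v vE] : exists v, v = - (b%:~R / a%:~R) - w.
  by exists (- (b%:~R / a%:~R) - w).
rewrite -vE in cw1 cw0.
(* [b] is even because [b ^+ 2 - 4 * a * c = 4 * N]. *)
have [k bk] : exists k, b = - (2 * k).
  have [i ei] : exists i, b = 2 * i + (b %% 2)%Z by exists (b %/ 2)%Z; lia.
  exists (- i); have b2 : (b %% 2)%Z = 0 \/ (b %% 2)%Z = 1 by lia.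
  case: b2 => r; rewrite r in ei; first by lia.
  by move: eD; rewrite ei; clear; lia.
have ak : 2 * k%:~R = a%:~R * (v + w) :> R.
  by rewrite vE subrK bk rmorphN rmorphM /=; field.
have ac : c%:~R = a%:~R * (v * w) :> R.
  move: e; rewrite /int_quad_root bk rmorphN rmorphM /= ak => e; lra.
have NE : N = k ^+ 2 + a * - c by move: eD; rewrite bk; lia.
exists (a, k, - c); rewrite /reduced_form /form_root.
  rewrite a0 NE eqxx /=; apply/and3P; split.
  - by rewrite oppr_gt0 -(ltrz0 R) ac pmulr_rlt0 // nmulr_rlt0 //; lra.
  - rewrite -subr_gt0 -(ltr0z R) !(rmorphB, rmorphD, rmorphN, rmorphM) /= ak ac.
    (* This product is minus the value of the form at [(1, 1)]; the next one is the value at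
       [(-1, 1)]. *)
    have : 0 < a%:~R * ((w - 1) * (1 - v)) by rewrite !mulr_gt0 //; lra.
    by lra.
  - rewrite -subr_gt0 -(ltr0z R) !(rmorphB, rmorphD, rmorphN, rmorphM) /= ak ac.
    have : 0 < a%:~R * ((w + 1) * (1 + v)) by rewrite !mulr_gt0 //; lra.
    by lra.
have kE : k%:~R = a%:~R * (v + w) / 2 :> R by rewrite -ak; field.
have SE : S = a%:~R * (w - v) / 2.
  rewrite /S; have -> : N%:~R = (a%:~R * (w - v) / 2) ^+ 2 :> R.
    by rewrite NE !(rmorphD, rmorphM, rmorphXn, rmorphN) /= ac kE; field.
  by rewrite sqrtr_sqr ger0_norm // divr_ge0 // mulr_ge0 //; lra.
by rewrite kE SE; field.
Qed.

Lemma reduced_of_discE :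
  reduced_of_disc (4 * N) = form_root @` [set t | reduced_form N t].
Proof.
apply/seteqP; split=> [w [rw dw]|w [t rt <-]].
  by have [t rt <-] := reduced_is_form_root rw dw; exists t.
exact: form_root_reduced.
Qed.
End ReducedNumbers.

(** * Counting reduced forms modulo 4 *)

Section Counting.
Local Open Scope ring_scope.
Variables (N s : int) (A : {fset int * int * int}).
Hypotheses (s0 : 0 <= s) (sN : s ^+ 2 < N) (Ns : N < (s + 1) ^+ 2).
Hypothesis N3 : (N %% 4)%Z = 3.
Hypothesis AE : forall t, (t \in A) = reduced_form N t.

(** [swap] exchanges the forms of the two characters bijectively. *)
Lemma card_chi4_pos : (#|` A| = 2 * #|` [fset t in A | chi4_pos t]%fset|)%N.
Proof.
have swapE : [fset t in A | ~~ chi4_pos t]%fset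
    = (swap @` [fset t in A | chi4_pos t])%fset.
  apply/fsetP => t; apply/idP/imfsetP => [|[u + ->]]; rewrite !inE /= !AE.
    case/andP => rt nt; exists (swap t); last by rewrite swapK.
    by rewrite !inE /= AE swap_reduced rt (chi4_swap N3 rt).
  by case/andP => ru cu; rewrite swap_reduced ru (chi4_swap N3 ru) cu.
have cardE : #|` [fset t in A | ~~ chi4_pos t]%fset|
    = #|` [fset t in A | chi4_pos t]%fset|.
  by rewrite swapE card_imfset //; exact: inv_inj swapK.
rewrite -(cardfsID [fset t in A | chi4_pos t]%fset A).
rewrite mul2n -addnn; congr (_ + _)%N.
  by congr #|` _|; apply/fsetP => t; rewrite !inE /=; case: (t \in A).
rewrite -[RHS]cardE; congr #|` _|; apply/fsetP => t; rewrite !inE /=.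
by case: (t \in A); rewrite ?andbT ?andbF.
Qed.

Lemma odd_card_chi4_pos (r r' : nat) : prime r -> prime r' -> (r < r')%N ->
  N = (r * r')%N%:Z -> odd #|` [fset t in A | chi4_pos t]%fset| = false.
Proof.
move=> rp r'p rr' NE; have r1 := prime_gt1 rp.
have r0 : 0 < r%:Z by lia.
have rN : r%:Z * r'%:Z = N by rewrite NE.
have rs : r%:Z <= s by rewrite leNgt; apply/negP => h; clear -h rr' Ns NE s0;
  nia.
have s1 : 1 <= s by lia.
rewrite (odd_card_fixpoints (f := mirror s)); first last.
- by move=> t; rewrite !inE /= AE => /andP[/mirrorK -> //].
- move=> t; rewrite !inE /= !AE => /andP[rt ct].
  by rewrite mirror_reduced //= (chi4_mirror s N3 rt).
pose F := [:: even_fixed s 1 N; odd_fixed s 1 N;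
  even_fixed s r%:Z r'%:Z; odd_fixed s r%:Z r'%:Z].
(* The first entries 1, 2, [r], [2 * r] are distinct, since [r] is odd and greater than 1. *)
have uF : uniq F.
  have [|r2 _] := @odd_mul r%:Z r'%:Z; first by rewrite rN; lia.
  by rewrite /F /= !inE /even_fixed /odd_fixed !xpair_eqE; clear -r1 r2; lia.
have FE t : (t \in F) = reduced_form N t && (mirror s t == t).
  apply/idP/andP => [|[rt /eqP ft]].
    have r1s : 1 * N = N by rewrite mul1r.
    rewrite !inE => /or4P[] /eqP ->.
    - by have [-> ->] := even_fixedP s0 sN Ns ltr01 s1 r1s.
    - by have [-> ->] := odd_fixedP s0 sN Ns N3 ltr01 s1 r1s.
    - by have [-> ->] := even_fixedP s0 sN Ns r0 rs rN.
    - by have [-> ->] := odd_fixedP s0 sN Ns N3 r0 rs rN.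
  have [d [d' [d0 ds dN te]]] := mirror_fixed s0 sN Ns rt ft.
  have [[ed ed']|[ed ed']] : (d = 1 /\ d' = N) \/ (d = r%:Z /\ d' = r'%:Z).
    have dd : d ^+ 2 < N
      by rewrite (le_lt_trans _ sN) // lerXn2r // ?nnegrE ltW.
    case: d d0 ds dN dd {te} => // d d0 ds dN dd.
    have : 0 < d' by rewrite -(pmulr_rgt0 _ d0) dN; lia.
    case: d' dN => // d' dN d'0.
    have e : (d * d' = r * r')%N by lia.
    have {}dd : (d * d < r * r')%N by rewrite NE in dd; clear -dd; lia.
    have [dE|dE] := small_divisor_pq rp r'p rr' e dd.
    - by left; split; rewrite ?dE // -dN dE mul1r.
    - right; split; rewrite ?dE //; congr Posz.
      by apply/eqP; rewrite -(@eqn_pmul2l r) ?prime_gt0 // -e dE.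
  - by rewrite ed ed' in te; case: te => ->; rewrite !inE eqxx ?orbT.
  - by rewrite ed ed' in te; case: te => ->; rewrite !inE eqxx ?orbT.
pose G := [seq t <- F | chi4_pos t].
have GE t : (t \in G) = chi4_pos t && (reduced_form N t && (mirror s t == t)).
  by rewrite mem_filter FE.
have uG : uniq G by rewrite filter_uniq.
have oG : odd (size G) = false.
  by rewrite size_filter /= !addnA addn0; apply: chi4_fixed_even.
clearbody G.
have -> : [fset t in [fset t in A | chi4_pos t]%fset | mirror s t == t]%fset
    = [fset t in G]%fset.
  by apply/fsetP => t; rewrite !inE /= GE AE andbA (andbC (reduced_form N t)).
by rewrite card_fseq undup_id.
Qed.
End Counting.

(** * From the count of forms to [kappa] *)

Section Caliber.
Local Open Scope ring_scope.

Lemma isqrt_exists (N : nat) : exists s : nat, (s ^ 2 <= N < (s + 1) ^ 2)%N.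
Proof.
have ex : exists n, (n ^ 2 <= N)%N by exists 0%N.
have bd n : (n ^ 2 <= N)%N -> (n <= N)%N by nia.
case: (ex_maxnP ex bd) => s sN smax; exists s; rewrite sN ltnNge.
by apply/negP => /smax; rewrite addn1 ltnn.
Qed.

(** A prime factor of [g] would be [p] or [q], and its square dividing [p * q] would force
    [p = q]. *)
Lemma sqfree_pq (p q : nat) (g : int) : prime p -> prime q -> p != q ->
  0 < g -> (g ^+ 2 %| (p * q)%N%:Z)%Z -> g = 1.
Proof.
move=> pp qp pq; case: g => // g g0; rewrite dvdzE abszX !absz_nat => gd.
congr Posz; apply/eqP; rewrite eqn_leq andbC; apply/andP; split => //;
  rewrite leqNgt; apply/negP => g1.
have lp := pdiv_prime g1; set l := pdiv g in lp.
have ld : (l ^ 2 %| p * q)%N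
  by rewrite (dvdn_trans _ gd) // dvdn_exp2r // pdiv_dvd.
have : (l %| p * q)%N by rewrite (dvdn_trans _ ld) // dvdn_exp.
rewrite Euclid_dvdM // !dvdn_prime2 // => /orP[] /eqP lE; move: ld.
  by rewrite lE expnS expn1 dvdn_pmul2l ?prime_gt0 // dvdn_prime2 // (negPf pq).
rewrite lE expnS expn1 dvdn_pmul2r ?prime_gt0 // dvdn_prime2 // eq_sym.
by rewrite (negPf pq).
Qed.

Lemma kappa_pq (R : realType) (p q : nat) : prime p -> prime q -> (p < q)%N ->
  (p * q = 3 %[mod 4])%N -> (4 %| kappa R (4 * (p * q)%N%:Z))%N.
Proof.
move=> pp qp pq N3'; set N := (p * q)%N%:Z.
have N3 : (N %% 4)%Z = 3 by rewrite /N; lia.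
have N0 : 0 < N by rewrite /N; lia.
have Nsq g : 0 < g -> (g ^+ 2 %| N)%Z -> g = 1.
  by apply: sqfree_pq => //; rewrite neq_ltn pq.
have [s /andP[sN Ns]] := isqrt_exists (p * q).
(* Strict, since 3 is not a square modulo 4. *)
have sNlt : s%:Z ^+ 2 < N.
  rewrite /N lt_neqAle; apply/andP; split; last by clear -sN; lia.
  apply/eqP => e; move: N3; rewrite /N -e; clear.
  have [i ei] : exists i, s = (2 * i + s %% 2)%N by exists (s %/ 2)%N; lia.
  have [r|r] : (s %% 2 = 0 \/ s %% 2 = 1)%N by lia.
    by rewrite r in ei; rewrite ei; lia.
  by rewrite r in ei; rewrite ei; lia.
have Ns' : N < (s%:Z + 1) ^+ 2 by clear -Ns; rewrite /N; lia.
pose X := [set t | reduced_form N t]%classic.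
have redE := reduced_of_discE R N0 N3 Nsq.
have injX : {in X &, injective (form_root R N)}.
  by move=> t u; rewrite !inE => rt ru; apply: (form_root_inj N0 N3).
have cardE := inj_card_eq injX.
have fR := finite_reduced_of_disc R (4 * N).
(* Finiteness is carried over from the reduced numbers, so [fset_set X] is not the default empty
   set. *)
have fX : finite_set X by rewrite -(eq_finite_set cardE) -redE.
rewrite /kappa;
  have /(fcard_eq fR fX) -> : (@reduced_of_disc R (4 * N) #= X)%card.
  by rewrite redE.
have AE t : (t \in fset_set X) = reduced_form N t.
  by rewrite in_fset_set //; apply/idP/idP; rewrite inE.
rewrite (card_chi4_pos N3 AE).
have := odd_card_chi4_pos (isT : 0 <= s%:Z) sNlt Ns' N3 AE pp qp pq erefl.
by lia.
Qed.

End Caliber.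

Theorem theorem3p16 (R : realType) (p q : nat)
    (p_prime : prime p) (q_prime : prime q)
    (p_mod4 : p = 1 %[mod 4]) (q_mod4 : q = 3 %[mod 4]) :
  kappa R (Posz (4 * p * q)) = 0 %[mod 4].
Proof.
have pq3 : p * q = 3 %[mod 4] by rewrite -modnMm p_mod4 q_mod4.
have -> : Posz (4 * p * q) = (4 * Posz (p * q))%R by rewrite -mulnA PoszM.
(* The product is symmetric, so the smaller prime can come first; [p = q] contradicts the
   residues. *)
rewrite mod0n; apply/eqP; case: (ltngtP p q) => [pq|qp|pq].
- exact: kappa_pq.
- by rewrite mulnC; apply: kappa_pq => //; rewrite mulnC.
- by move: p_mod4; rewrite pq q_mod4.
Qed.
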